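(* Let $\Omega$ be an arbitrary open set in $\mathbb R^n$ ($n\ge 2$), with connected components $(C_m)_{m\in M}$, and let $(k_m)_{m\in M}$ be a non-decreasing sequence in $\mathbb N$ and $(\pi_m)_{m\in M}$ a sequence of dyadic cubes such that $\pi_m\in\Pi_{k_m}$ and $\pi_m\subset C_m$ for all $m\in M$. Let $(\Omega^{\square}_k)_{k\in\mathbb N}$ be the dyadic approximations of $\Omega$ rooted in $(\pi_m)_{m\in M}$. Then: (i) $(\Omega^{\square}_k)_{k\in\mathbb N}$ is a non-decreasing sequence of open subsets of $\Omega$; (ii) $\Omega^{\square}_k\to\Omega$ pointwise and in the sense of characteristic functions; (iii) $\Omega^{\square}_k\to\Omega$ in the sense of compact sets. In addition, if $B$ is an open ball, then (iv) $\Omega^{\square}_k\cap B\to\Omega\cap B$ in the sense of Hausdorff; (v) $\partial(\Omega^{\square}_k\cap B)\to\partial(\Omega\cap B)$ for the Hausdorff distance on compact sets.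
   Context: Dyadic grid: for $k\in\mathbb N$, $\Pi_k=\{\pi^k_j : j\in\mathbb Z^n\}$ with $\pi^k_j=\prod_{m=1}^n[2^{-k}j_m,2^{-k}(j_m+1)]$. A set $Q\subset\mathbb R^n$ is drawn on $\Pi_k$ if $Q=\bigcup_{\pi\in\mathcal Q}\pi$ for some $\mathcal Q\subset\Pi_k$. The index set is $M=\{0,\dots,N\}$ for some $N\in\mathbb N$, or $M=\mathbb N$. For a connected component $C_m$ and $k\ge k_m$, let $\overline{(C_m)}^{\square}_k$ be the largest (for inclusion) set $A$ drawn on $\Pi_k$ such that $\pi_m\subset A\subset C_m$ and the interior of $A$ is connected. Set $\overline\Omega^{\square}_k=\bigcup_{m\in M,\,k_m\le k}\overline{(C_m)}^{\square}_k$. The dyadic approximation of $\Omega$ of order $k$ rooted in $(\pi_m)_{m\in M}$ is the interior $\Omega^{\square}_k$ of $\overline\Omega^{\square}_k$ (it is empty if no $k_m\le k$). Modes of convergence of open sets $U_k\to U$: - pointwise: $\mathbf 1_{U_k}\to\mathbf 1_U$ pointwise on $\mathbb R^n$; - in the sense of characteristic functions: $\mathbf 1_{U_k}\to\mathbf 1_U$ in $L^p_{\mathrm{loc}}(\mathbb R^n)$ for all $p\in[1,\infty)$; - in the sense of compact sets: every compact $K\subset U$ satisfies $K\subset U_k$ for all large $k$, and every compact $K\subset\mathbb R^n\setminus\overline U$ satisfies $K\subset\mathbb R^n\setminus\overline{U_k}$ for all large $k$; - in the sense of Hausdorff, for open subsets of a ball $B$: the Hausdorff distance between the compact sets $\overline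 B\setminus U_k$ and $\overline B\setminus U$ tends to $0$. In (v), the Hausdorff distance between two empty sets is $0$, and the convergence concerns $k$ large enough. *)

(* Defs.v *)
From HB Require Import structures.
From mathcomp Require Import all_boot all_order all_algebra.
From mathcomp Require Import all_classical all_reals all_analysis.

Set Implicit Arguments.
Unset Strict Implicit.
Unset Printing Implicit Defensive.

Import Order.TTheory GRing.Theory Num.Theory.
Import numFieldNormedType.Exports.

Local Open Scope classical_set_scope.
Local Open Scope ring_scope.

(* R^n is 'rV[R]_n with its product topology.  The norm provided by the library
   on 'rV[R]_n is the sup norm; balls and distances below are Euclidean. *)
Section euclidean.
Context {R : realType} {n : nat}.
Implicit Types (x y c : 'rV[R]_n) (A B : set 'rV[R]_n).

Definition euclidean_norm x : R := Num.sqrt (\sum_(i < n) x 0 i ^+ 2).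

Definition euclidean_ball c (r : R) : set 'rV[R]_n :=
  [set x | euclidean_norm (x - c) < r].

Definition dist_to_set x A : \bar R :=
  ereal_inf [set (euclidean_norm (x - y))%:E | y in A].

(* With ereal_sup set0 = -oo and ereal_inf set0 = +oo, the leading maximum with
   0 makes the distance between two empty sets 0, while the distance between an
   empty set and a nonempty one is +oo. *)
Definition hausdorff_dist A B : \bar R :=
  maxe 0%E (maxe (ereal_sup [set dist_to_set x B | x in A])
                 (ereal_sup [set dist_to_set y A | y in B])).

Definition boundary A : set 'rV[R]_n := closure A `\` interior A.

End euclidean.

Section lebesgue_n.
Context {R : realType}.

Definition pair_cons n (xt : measurableTypeR R * n.-tuple (measurableTypeR R)) :
  n.+1.-tuple (measurableTypeR R) := [tuple of xt.1 :: xt.2].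

Lemma measurable_pair_cons n : measurable_fun setT (@pair_cons n).
Proof. exact: measurable_cons. Qed.

Section step.
Context (n : nat).
Variable mu : {sigma_finite_measure
  set (n.-tuple (measurableTypeR R)) -> \bar R}.

Definition lebesgue_step : set (n.+1.-tuple (measurableTypeR R)) -> \bar R :=
  pushforward (lebesgue_measure \x mu)%E (@pair_cons n).

Let lebesgue_step0 : lebesgue_step set0 = 0%E.
Proof. by rewrite /lebesgue_step /pushforward preimage_set0 measure0. Qed.

Let lebesgue_step_ge0 A : (0 <= lebesgue_step A)%E.
Proof. exact: (measure_ge0 (lebesgue_measure \x mu)%E). Qed.

Let measurable_preimage_cons A : measurable A ->
  measurable (@pair_cons n @^-1` A).
Proof.
by move=> mA; rewrite -[X in measurable X]setTI; exact: measurable_pair_cons.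
Qed.

Let lebesgue_step_sigma_additive : semi_sigma_additive lebesgue_step.
Proof.
move=> F mF tF mUF; rewrite /lebesgue_step /pushforward preimage_bigcup.
apply: measure_semi_sigma_additive.
- by move=> k; exact: measurable_preimage_cons.
- apply/trivIsetP => /= i j _ _ ij; rewrite -preimage_setI.
  by move/trivIsetP : tF => /(_ _ _ _ _ ij) ->//; rewrite preimage_set0.
- by rewrite -preimage_bigcup; exact: measurable_preimage_cons.
Qed.

HB.instance Definition _ := isMeasure.Build _ _ _ lebesgue_step
  lebesgue_step0 lebesgue_step_ge0 lebesgue_step_sigma_additive.

Let lebesgue_step_sigma_finite : sigma_finite setT lebesgue_step.
Proof.
have /sigma_finiteP[F [TF ndF Foo]] := sigma_finiteT (@lebesgue_measure R).
have /sigma_finiteP[G [TG ndG Goo]] := sigma_finiteT mu.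
pose u (t : n.+1.-tuple (measurableTypeR R)) := (thead t, [tuple of behead t]).
have consK xt : u (pair_cons xt) = xt.
  by case: xt => x t; congr pair; apply/val_inj.
have measurable_u : measurable_fun setT u.
  by apply/measurable_fun_pair; [exact: measurable_tnth|exact: measurable_behead].
have FGT : \bigcup_k (F k `*` G k) = setT.
  rewrite -setXTT TF TG predeqE => -[x y]; split.
    by move=> [k _ []/= ? ?]; split; exists k.
  move=> [/= [i _ Fix] [j _ Gjy]]; exists (maxn i j) => //; split.
  - by move: x Fix; exact/subsetPset/ndF/leq_maxl.
  - by move: y Gjy; exact/subsetPset/ndG/leq_maxr.
exists (fun k => u @^-1` (F k `*` G k)).
  by rewrite -preimage_bigcup FGT preimage_setT.
move=> k; have [mF Fk] := Foo k; have [mG Gk] := Goo k; split.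
  by rewrite -[X in measurable X]setTI; apply: measurable_u => //; exact: measurableX.
rewrite /lebesgue_step /pushforward -comp_preimage.
rewrite (_ : u \o _ = id) ?preimage_id; last exact/funext.
by rewrite product_measure1E// lte_mul_pinfty// ge0_fin_numE.
Qed.

HB.instance Definition _ := Measure_isSigmaFinite.Build _ _ _ lebesgue_step
  lebesgue_step_sigma_finite.

End step.

(* Lebesgue measure on R^n, as the n-fold product of the one on R (the one-point
   space R^0 has mass 1).  It is carried by n-tuples, which the library equips
   with the product sigma-algebra. *)
Fixpoint lebesgue_tuple n :
    {sigma_finite_measure set (n.-tuple (measurableTypeR R)) -> \bar R} :=
  if n is n'.+1 then lebesgue_step (lebesgue_tuple n')
  else dirac ([tuple] : 0.-tuple (measurableTypeR R)).

Definition row_of_tuple n (t : n.-tuple (measurableTypeR R)) : 'rV[R]_n :=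
  \row_(i < n) tnth t i.

End lebesgue_n.

Section modes_of_convergence.
Context {R : realType} {n : nat}.
Implicit Types (U : set 'rV[R]_n) (Us : nat -> set 'rV[R]_n).

Definition cvg_pointwise Us U : Prop :=
  forall x, (\1_(Us k) x : R) @[k --> \oo] --> (\1_U x : R).

Definition cvg_Lploc (p : R) (f_ : nat -> 'rV[R]_n -> R) (f : 'rV[R]_n -> R) :=
  forall K : set 'rV[R]_n, compact K ->
    Lnorm (lebesgue_tuple n) p%:E
      (fun t => (((f_ k \- f) \_ K) (row_of_tuple t))%:E)
    @[k --> \oo] --> (0 : \bar R)%E.

Definition cvg_characteristic Us U : Prop :=
  forall p : R, 1 <= p -> cvg_Lploc p (fun k => \1_(Us k)) \1_U.

Definition cvg_compact Us U : Prop :=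
  (forall K, compact K -> K `<=` U -> \forall k \near \oo, K `<=` Us k) /\
  (forall K, compact K -> K `<=` ~` closure U ->
    \forall k \near \oo, K `<=` ~` closure (Us k)).

Definition cvg_hausdorff (A_ : nat -> set 'rV[R]_n) (A : set 'rV[R]_n) : Prop :=
  hausdorff_dist (A_ k) A @[k --> \oo] --> (0 : \bar R)%E.

Definition cvg_hausdorff_open (B : set 'rV[R]_n) Us U : Prop :=
  cvg_hausdorff (fun k => closure B `\` Us k) (closure B `\` U).

End modes_of_convergence.

Section dyadic.
Context {R : realType} {n : nat}.
Implicit Types (A C Q pi : set 'rV[R]_n) (k : nat).

Definition dyadic_cube k (j : 'I_n -> int) : set 'rV[R]_n :=
  [set x | forall m : 'I_n,
    2 ^- k * (j m)%:~R <= x 0 m <= 2 ^- k * ((j m)%:~R + 1)].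

Definition dyadic_grid k : set (set 'rV[R]_n) := range (dyadic_cube k).

Definition drawn_on k Q : Prop :=
  exists2 P : set (set 'rV[R]_n), P `<=` dyadic_grid k & Q = \bigcup_(pi in P) pi.

Definition largest (P : set (set 'rV[R]_n)) A : Prop :=
  P A /\ forall A', P A' -> A' `<=` A.

(* The default set0 of xget is only a placeholder: when pi is a cube of the grid
   of order <= k contained in the connected set C, the largest such A exists. *)
Definition component_approximation C pi k : set 'rV[R]_n :=
  xget set0 [set A | largest
    [set A' | [/\ drawn_on k A', pi `<=` A', A' `<=` C & connected (interior A')]] A].

Definition closed_dyadic_approximation (M : set nat) (C_ : nat -> set 'rV[R]_n)
    (k_ : nat -> nat) (pi_ : nat -> set 'rV[R]_n) k : set 'rV[R]_n :=
  \bigcup_(m in [set m | M m /\ (k_ m <= k)%N]) component_approximation (C_ m) (pi_ m) k.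

Definition dyadic_approximation (M : set nat) (C_ : nat -> set 'rV[R]_n)
    (k_ : nat -> nat) (pi_ : nat -> set 'rV[R]_n) k : set 'rV[R]_n :=
  interior (closed_dyadic_approximation M C_ k_ pi_ k).

Definition index_set (M : set nat) : Prop :=
  (exists N : nat, M = [set m | (m <= N)%N]) \/ M = setT.

Definition enumerates_components (Omega : set 'rV[R]_n) (M : set nat)
    (C_ : nat -> set 'rV[R]_n) : Prop :=
  set_bij M [set connected_component Omega x | x in Omega] C_.

End dyadic.

(* Main.v *)
Require Import Defs.
From mathcomp Require Import all_boot all_order all_algebra.
From mathcomp Require Import all_classical all_reals all_analysis.
From mathcomp Require Import lra.
Import Order.TTheory GRing.Theory Num.Theory.
Import numFieldNormedType.Exports.
Local Open Scope classical_set_scope.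
Local Open Scope ring_scope.
Set Implicit Arguments.
Unset Strict Implicit.
Unset Printing Implicit Defensive.

(** The whole statement follows from one fact: the sets Omega_k form a
    non-decreasing sequence of open sets whose union is Omega
    ([dyadic_approximation_bigcup]).

    That the union is everything is proved one component C at a time.  Write A_k
    for the approximation of C at order k and V for the union of the interiors of
    the A_k; it is an open subset of C.  It is also closed in C: if x in C is
    adherent to V, a box Q of tiny dyadic cubes around x, contained in C, meets
    the interior of some A_k.  Refining the grid so that A_k and Q are both drawn
    on it, the union of A_k and Q is again drawn on that grid and its interior is
    connected, so by maximality Q lies in a later approximation and x lies in V
    ([component_approximation_exhaustion]).  As C is connected, V is all of C.
    What makes such gluings work is that a set drawn on a grid lies in the
    closure of its interior ([drawn_sub_closure_interior]): the union of the
    interiors of two drawn sets, although smaller than the interior of the union,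
    is dense in it ([connected_interior_bigcup]).  The same remark shows that the
    union of all competitors is a competitor, so that a largest one exists.

    The modes of convergence then hold for any non-decreasing sequence of open
    sets U_k with union U, mostly because a compact subset of U lies in some U_k
    ([exhaustion_compact]).
    - Characteristic functions: the L^p norm over a compact K is a power of the
      measure of the points of K lying in U but not in U_k; these sets decrease
      to the empty set and have finite measure.
    - Complements in a compact K: the points of K at distance at least e from all
      points of K outside U form a compact subset of U, hence eventually lie in
      U_k; so every point of K outside U_k is e-close to a point of K outside U.
    - Boundaries: a boundary point of U_k is a point of the closure of U outside
      U_k, to which the previous argument applies.  Conversely, for large k each
      boundary point y of U is e-close to some z in U_k, and the segment from y to
      z has to leave U_k through its boundary ([segment_meets_boundary]).

    The last two items are used with the intersections of Omega_k and Omega with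
    the ball B, which again form an exhaustion, of relatively compact sets. *)

(** * Connectedness *)

(** In a separation of A, the connected set S lies in one part; since S is dense
    in A, the other part is empty. *)
Lemma connected_between (T : topologicalType) (S A : set T) :
  connected S -> S `<=` A -> A `<=` closure S -> connected A.
Proof.
move=> cS SA AS; apply: contrapT => /connectedPn[E [E0 AE sE]].
have key b : S `<=` E b -> False.
  move=> SEb; have [x Ex] := E0 (~~ b).
  have : (closure (E b) `&` E (~~ b)) x.
    split=> //; apply: (closureS SEb); apply: AS; rewrite AE.
    by case: b Ex {SEb} => /=; [left|right].
  suff -> : closure (E b) `&` E (~~ b) = set0 by [].
  by case: sE => s1 s2; case: (b) => //=; rewrite setIC.
have := @connected_subset _ _ _ S sE; rewrite -AE => /(_ SA cS).
by case; exact: key.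
Qed.

(** The union of the interiors is connected, because they share c, and the
    density hypothesis makes it dense in the interior of the union. *)
Lemma connected_interior_bigcup (T : topologicalType) (I : Type) (D : set I)
    (F : I -> set T) (c : T) :
  (forall i, D i -> F i `<=` closure (interior (F i))) ->
  (forall i, D i -> connected (interior (F i))) ->
  (forall i, D i -> interior (F i) c) ->
  connected (interior (\bigcup_(i in D) F i)).
Proof.
move=> FS cF Fc; apply: (@connected_between _ (\bigcup_(i in D) interior (F i))).
- by apply: bigcup_connected => //; exists c.
- move=> x [i Di Fx]; by apply: filterS Fx => y Fy; exists i.
- move=> x /interior_subset[i Di Fx].
  by apply: closureS (FS i Di x Fx) => y Fy; exists i.
Qed.

Section segments.
Context {R : realType} {V : normedModType R}.
Implicit Types (y z : V) (A : set V).

Definition segment y z : set V := [set y + t *: (z - y) | t in `[0, 1]].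

Lemma segment_param_continuous y z : continuous (fun t : R => y + t *: (z - y)).
Proof.
move=> t; apply: cvgD; first exact: cvg_cst.
by apply: cvgZr_tmp => //; exact: cvg_id.
Qed.

Lemma connected_segment y z : connected (segment y z).
Proof.
apply: connected_continuous_connected; first exact: segment_connected.
by apply: continuous_subspaceT => t; exact: segment_param_continuous.
Qed.

Lemma segment_start y z : segment y z y.
Proof. by exists 0; rewrite ?scale0r ?addr0//= in_itv/= lexx ler01. Qed.

Lemma segment_end y z : segment y z z.
Proof.
by exists 1; rewrite ?scale1r ?(addrC y) ?subrK//= in_itv/= lexx ler01.
Qed.

Lemma convex_connected A :
  (forall y z, A y -> A z -> segment y z `<=` A) -> connected A.
Proof.
move=> Aconv; have [->|/set0P[y Ay]] := eqVneq A set0; first exact: connected0.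
rewrite (_ : A = \bigcup_(z in A) segment y z).
  apply: bigcup_connected; last by move=> z _; exact: connected_segment.
  by exists y => z _; exact: segment_start.
apply/seteqP; split => [z Az|x [z Az]]; last exact: Aconv.
by exists z => //; exact: segment_end.
Qed.

(** Used with y a point of a closed box and z its center. *)
Lemma closure_segment y z A :
  (forall t : R, 0 < t <= 1 -> A (y + t *: (z - y))) -> closure A y.
Proof.
move=> At B By.
have cont : (fun t : R => y + t *: (z - y)) @ 0^'+ --> y.
  rewrite -[X in _ --> X]addr0 -(scale0r (z - y)).
  exact/cvg_at_right_filter/segment_param_continuous.
have : \forall t \near 0^'+, B (y + t *: (z - y)) by exact: cont By.
move=> nB; near (0 : R)^'+ => t; exists (y + t *: (z - y)); split.
  by apply: At; apply/andP; split; near: t; [exact: nbhs_right_gt|exact: nbhs_right_le].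
by near: t.
Unshelve. all: by end_near. Qed.

End segments.

(** Balls are convex, so a ball contained in A stays in one component. *)
Lemma connected_component_open {R : realType} {V : normedModType R}
  (A : set V) (x : V) : open A -> open (connected_component A x).
Proof.
rewrite !openE => oA y Ay; have /oA := connected_component_sub Ay.
move=> /nbhs_ballP[e /= e0 yeA].
apply: filterS (nbhsx_ballx y e e0); rewrite (same_connected_component Ay).
apply: connected_component_max => //; first exact: ballxx.
apply: convex_connected => u v; rewrite -ball_normE /= => yu yv _ [t + <-].
rewrite /= in_itv/= => /andP[t0 t1].
(* The point at parameter t is the convex combination of u and v. *)
rewrite (_ : y - _ = (1 - t) *: (y - u) + t *: (y - v)); last first.
  rewrite scalerBl scale1r -addrA [- _ + _]addrC -scalerBr opprB [y - v + _]addrC.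
  by rewrite addrA subrK opprD addrA -scalerN opprB.
apply: le_lt_trans (ler_normD _ _) _; rewrite !normrZ ger0_norm ?subr_ge0//.
rewrite (ger0_norm t0); move: yu yv t0 t1; set p := `|y - u|; set q := `|y - v|.
by move=> pe qe t0 t1; have [t2|t2] := lerP t (1 / 2); nra.
Qed.

(** * Dyadic grids *)

Section boxes.
Context {R : realType} {n : nat}.
Implicit Types (u v : 'I_n -> R) (x : 'rV[R]_n).

Definition closed_box u v : set 'rV[R]_n := [set x | forall i, u i <= x 0 i <= v i].
Definition open_box u v : set 'rV[R]_n := [set x | forall i, u i < x 0 i < v i].

Lemma open_box_open u v : open (open_box u v).
Proof.
rewrite openE => x xuv; exists (fun _ j => `]u j, v j[%classic).
  move=> i j; rewrite (ord1 i); apply: open_nbhs_nbhs; split=> //=.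
  by rewrite in_itv/=; exact: xuv.
by move=> y /= yuv i; have := yuv 0 i; rewrite in_itv.
Qed.

Lemma open_box_connected u v : connected (open_box u v).
Proof.
apply: convex_connected => x y ux uy _ [t + <-] i.
rewrite /= in_itv/= !mxE => /andP[t0 t1].
have /andP[] := ux i; have /andP[] := uy i.
move: (x 0 i) (y 0 i) (u i) (v i) => a b c d bc bd ac ad.
by apply/andP; split; have [t2|t2] := lerP t (1 / 2); nra.
Qed.

Lemma open_box_sub_interior u v : open_box u v `<=` interior (closed_box u v).
Proof.
move=> x xuv; have := @open_box_open u v; rewrite openE => /(_ _ xuv).
by apply: filterS => y yuv i; have /andP[/ltW-> /ltW->] := yuv i.
Qed.

Variables (u v : 'I_n -> R).
Hypothesis uv : forall i, u i < v i.

Let center : 'rV[R]_n := \row_i ((u i + v i) / 2).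

Lemma open_box_center : open_box u v center.
Proof. by move=> i; rewrite mxE; have := uv i; lra. Qed.

Lemma closed_box_sub_closure : closed_box u v `<=` closure (open_box u v).
Proof.
move=> x xuv; apply: (@closure_segment _ _ _ center) => t t01 i.
have := xuv i; have := uv i; rewrite !mxE; move: (x 0 i) (u i) (v i) t01.
move=> a c d /andP[t0 t1] cd /andP[ca ad].
by apply/andP; split; nra.
Qed.

Lemma interior_closed_box_connected : connected (interior (closed_box u v)).
Proof.
apply: (connected_between (@open_box_connected u v)).
  exact: open_box_sub_interior.
by move=> x /interior_subset; exact: closed_box_sub_closure.
Qed.

End boxes.

Section drawn.
Context {R : realType} {n : nat}.
Implicit Types (A C Q pi : set 'rV[R]_n) (k l : nat).

Lemma drawn_on_bigcup k (I : Type) (D : set I) (F : I -> set 'rV[R]_n) :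
  (forall i, D i -> drawn_on k (F i)) -> drawn_on k (\bigcup_(i in D) F i).
Proof.
move=> dF; exists [set pi | dyadic_grid k pi /\ exists2 i, D i & pi `<=` F i].
  by move=> pi [].
apply/seteqP; split => [x [i Di Fx]|x [pi [_ [i Di piF]] pix]]; last first.
  by exists i => //; exact: piF.
have [P Pk FE] := dF i Di; move: (Fx); rewrite FE => -[pi Ppi pix].
exists pi => //; split; first exact: Pk.
by exists i => // y piy; rewrite FE; exists pi.
Qed.

(** The rounded-down index of x works unless x is the right endpoint, which
    belongs to the last interval only. *)
Lemma dyadic_interval k (a b : int) (x : R) : (a < b)%R ->
  2 ^- k * a%:~R <= x <= 2 ^- k * b%:~R ->
  exists j : int, [/\ (a <= j)%R, (j + 1 <= b)%R &
    2 ^- k * j%:~R <= x <= 2 ^- k * (j%:~R + 1)].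
Proof.
move=> ab; set s := 2 ^- k; have s0 : 0 < s by rewrite invr_gt0 exprn_gt0.
rewrite -ler_pdivrMl// -ler_pdivlMl//; set X := s^-1 * x.
move=> /andP[aX Xb]; have [bX|{}Xb] := leP b%:~R X.
  exists (b - 1); split; [by rewrite lerBrDr lezD1|by rewrite subrK|].
  by rewrite -ler_pdivrMl// -ler_pdivlMl// -/X rmorphB/=; lra.
exists (Num.floor X); have /andP[fX Xf] := floor_itv X; split.
- by rewrite floor_ge_int.
- by rewrite lezD1 floor_lt_int.
- by rewrite -ler_pdivrMl// -ler_pdivlMl// -/X fX/= ltW// -intrD1.
Qed.

(** A dyadic cube is such a box at every finer order, and so are arbitrarily
    small neighborhoods of a point; both uses need corners on the grid only. *)
Lemma closed_box_drawn k (a b : 'I_n -> int) : (forall i, (a i < b i)%R) ->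
  drawn_on k (closed_box (fun i => 2 ^- k * (a i)%:~R : R)
                         (fun i => 2 ^- k * (b i)%:~R)).
Proof.
set Q := closed_box _ _ => ab.
exists [set pi | dyadic_grid k pi /\ pi `<=` Q]; first by move=> pi [].
apply/seteqP; split => [x Qx|x [pi [_ piQ]]]; last exact: piQ.
have /choice[j jP] : forall i, exists j : int, [/\ (a i <= j)%R, (j + 1 <= b i)%R &
    2 ^- k * j%:~R <= x 0 i <= 2 ^- k * (j%:~R + 1)].
  by move=> i; apply: dyadic_interval => //; exact: Qx.
exists (dyadic_cube k j); last by move=> i; have [] := jP i.
split; first by exists j.
move=> y yj i; have [aj jb _] := jP i; have /andP[jy yj1] := yj i.
apply/andP; split.
  by apply: le_trans jy; rewrite ler_pM2l ?invr_gt0 ?exprn_gt0// ler_int.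
apply: le_trans yj1 _; rewrite ler_pM2l ?invr_gt0 ?exprn_gt0//.
by rewrite -intrD1 ler_int.
Qed.

Lemma dyadic_cube_box k (j : 'I_n -> int) : dyadic_cube k j =
  closed_box (fun i => 2 ^- k * (j i)%:~R : R) (fun i => 2 ^- k * (j i + 1)%:~R).
Proof.
by apply/seteqP; split => x xj i; have := xj i; rewrite intrD1.
Qed.

Lemma dyadic_cube_drawn k l (j : 'I_n -> int) : (k <= l)%N ->
  drawn_on l (dyadic_cube k j : set 'rV[R]_n).
Proof.
move=> kl; pose a (z : int) := (2 ^+ (l - k) * z)%R.
have aE (z : int) : 2 ^- k * z%:~R = 2 ^- l * (a z)%:~R :> R.
  rewrite /a rmorphM rmorphXn/= -[in 2 ^- l](subnK kl) exprD invfM.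
  by rewrite -mulrA mulrCA mulKf ?expf_neq0 ?pnatr_eq0.
rewrite dyadic_cube_box.
under [X in closed_box X]eq_fun do rewrite aE.
under [X in closed_box _ X]eq_fun do rewrite aE.
apply: closed_box_drawn => i; rewrite /a ltr_pM2l ?exprn_gt0//.
by rewrite ltzD1.
Qed.

Lemma drawn_on_le k l A : (k <= l)%N -> drawn_on k A -> drawn_on l A.
Proof.
move=> kl [P Pk ->]; apply: drawn_on_bigcup => pi /Pk [j _ <-].
exact: dyadic_cube_drawn.
Qed.

Lemma dyadic_width k (j : 'I_n -> int) i :
  2 ^- k * (j i)%:~R < 2 ^- k * (j i + 1)%:~R :> R.
Proof. by rewrite ltr_pM2l ?invr_gt0 ?exprn_gt0// ltr_int ltzD1. Qed.

(** Each cube lies in the closure of its own interior, and the interior of A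
    contains the interiors of all its cubes. *)
Lemma drawn_sub_closure_interior k A :
  drawn_on k A -> A `<=` closure (interior A).
Proof.
move=> [P Pk ->] x [pi Ppi pix]; have [j _ piE] := Pk _ Ppi.
move: pix; rewrite -piE dyadic_cube_box => pix.
apply: closureS (closed_box_sub_closure (dyadic_width k j) pix).
move=> y /open_box_sub_interior; apply: filterS => z zj.
by exists pi => //; rewrite -piE dyadic_cube_box.
Qed.

End drawn.

Section approximation_of_a_component.
Context {R : realType} {n : nat}.
Implicit Types (A C Q pi : set 'rV[R]_n) (x : 'rV[R]_n) (k l : nat).

(** Rounding the faces of the cube of half-side e / 2 outwards to the grid moves
    them by at most 2 ^- l, which keeps them within e of x. *)
Lemma small_drawn_box x (e : R) l : 0 < e -> 2 ^- l < e / 2 ->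
  exists Q, [/\ drawn_on l Q, Q `<=` ball x e, ball x (e / 2) `<=` interior Q
    & connected (interior Q)].
Proof.
move=> e0; set s := 2 ^- l => se; have s0 : 0 < s by rewrite invr_gt0 exprn_gt0.
have sD (z : int) : s * (z + 1)%:~R = s * z%:~R + s.
  by rewrite intrD1 [LHS]mulrDr [X in _ + X]mulr1.
pose a i := Num.floor (s^-1 * (x 0 i - e / 2)).
pose b i := Num.floor (s^-1 * (x 0 i + e / 2)) + 1.
have aP i : x 0 i - e < s * (a i)%:~R <= x 0 i - e / 2.
  rewrite -ler_pdivlMl// floor_le andbT.
  have /andP[_] := floor_itv (s^-1 * (x 0 i - e / 2)).
  by rewrite ltr_pdivrMl// -/(a i) sD; lra.
have bP i : x 0 i + e / 2 < s * (b i)%:~R < x 0 i + e.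
  rewrite -ltr_pdivrMl//; have /andP[+ ->/=] := floor_itv (s^-1 * (x 0 i + e / 2)).
  by rewrite ler_pdivlMl// /b sD; lra.
have ab i : s * (a i)%:~R < s * (b i)%:~R by have := aP i; have := bP i; lra.
exists (closed_box (fun i => s * (a i)%:~R) (fun i => s * (b i)%:~R)); split.
- by apply: closed_box_drawn => i; have := ab i; rewrite ltr_pM2l// ltr_int.
- move=> y yQ; split=> // i j; rewrite (ord1 i) /ball/= ltr_norml.
  by have := yQ j; have := aP j; have := bP j; lra.
- move=> y [_ xy]; apply: open_box_sub_interior => i; have := xy 0 i.
  by rewrite /ball/= ltr_norml; have := aP i; have := bP i; lra.
- exact: interior_closed_box_connected.
Qed.

(** The competitors among which [component_approximation] is the largest. *)
Definition admissible C pi k : set (set 'rV[R]_n) :=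
  [set A | [/\ drawn_on k A, pi `<=` A, A `<=` C & connected (interior A)]].

Lemma dyadic_cube_interior k pi : dyadic_grid k pi -> interior pi !=set0.
Proof.
move=> [j _ <-]; rewrite dyadic_cube_box.
by eexists; apply/open_box_sub_interior/open_box_center/dyadic_width.
Qed.

Lemma dyadic_cube_admissible C pi k l : dyadic_grid k pi -> (k <= l)%N ->
  pi `<=` C -> admissible C pi l pi.
Proof.
move=> [j _ <-] kl piC; split=> //; first exact: dyadic_cube_drawn.
by rewrite dyadic_cube_box; exact/interior_closed_box_connected/dyadic_width.
Qed.

(** The interiors of all competitors meet in the interior of the root cube, so
    their union has a connected interior; this is why a largest one exists. *)
Lemma admissible_bigcup C pi k (D : set (set 'rV[R]_n)) :
  interior pi !=set0 -> D !=set0 -> D `<=` admissible C pi k ->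
  admissible C pi k (\bigcup_(A in D) A).
Proof.
move=> [c pic] [A0 DA0] Dadm; split.
- by apply: drawn_on_bigcup => A /Dadm[].
- by have [_ piA0 _ _] := Dadm _ DA0 => x /piA0 A0x; exists A0.
- by move=> x [A /Dadm[_ _ sAC _]]; exact: sAC.
- apply: (@connected_interior_bigcup _ _ _ _ c) => A /Dadm[dA piA _ cA] //.
    exact: drawn_sub_closure_interior dA.
  exact: interiorS pic.
Qed.

Lemma component_approximation_largest C pi k l : dyadic_grid k pi ->
  (k <= l)%N -> pi `<=` C ->
  largest (admissible C pi l) (component_approximation C pi l).
Proof.
move=> kpi kl piC; apply: (@xgetPex _ set0 (largest (admissible C pi l))).
exists (\bigcup_(A in admissible C pi l) A); split.
  apply: admissible_bigcup => //; first exact: dyadic_cube_interior kpi.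
  by exists pi; exact: dyadic_cube_admissible kpi kl piC.
by move=> A admA x Ax; exists A.
Qed.

(** The approximation of order l is a competitor at the finer order m. *)
Lemma component_approximation_le C pi k l m : dyadic_grid k pi ->
  (k <= l <= m)%N -> pi `<=` C ->
  component_approximation C pi l `<=` component_approximation C pi m.
Proof.
move=> kpi /andP[kl lm] piC.
have [[dA piA sAC cA] _] := component_approximation_largest kpi kl piC.
have [_] := component_approximation_largest kpi (leq_trans kl lm) piC; apply.
by split=> //; exact: drawn_on_le dA.
Qed.

Lemma component_approximation_sub C pi k l : dyadic_grid k pi ->
  (k <= l)%N -> pi `<=` C -> component_approximation C pi l `<=` C.
Proof.
by move=> kpi kl piC; have [[]] := component_approximation_largest kpi kl piC.
Qed.

(** The union of the interiors is open and closed in C.  For closedness, a small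
    drawn box around an adherent point can be glued to a late approximation, and
    maximality absorbs it. *)
Lemma component_approximation_exhaustion C pi k : open C -> connected C ->
  dyadic_grid k pi -> pi `<=` C ->
  \bigcup_(l in [set l | (k <= l)%N]) interior (component_approximation C pi l) = C.
Proof.
move=> oC cC kpi piC; set V := \bigcup_(l in _) _.
have VC : V `<=` C.
  by move=> x [l kl /interior_subset]; exact: component_approximation_sub kpi kl piC x.
apply: cC.
- have [c pic] := dyadic_cube_interior kpi; exists c, k => //=.
  apply: interiorS pic.
  by have [[]] := component_approximation_largest kpi (leqnn k) piC.
- exists V; first by apply: bigcup_open => l _; exact: open_interior.
  by rewrite setIidr.
- exists (closure V); first exact: closed_closure.
  apply/seteqP; split => [x Vx|x [Cx clVx]].
    by split; [exact: VC|exact: subset_closure].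
  have /nbhs_ballP[e /= e0 xeC] : nbhs x C by move: oC Cx; rewrite openE; exact.
  have e20 : 0 < e / 2 by rewrite divr_gt0.
  have [y [[l kl ly] xy]] := clVx _ (nbhsx_ballx x (e / 2) e20).
  have [m [lm me]] : exists m, (l <= m)%N /\ 2 ^- m < e / 2.
    near \oo => m; exists m; split; first by near: m; exact: nbhs_infty_ge.
    rewrite -div1r; near: m; exact: (near_infty_natSinv_expn_lt (PosNum e20)).
  have [Q [dQ Qxe eQ cQ]] := small_drawn_box x e0 me.
  have km := leq_trans kl lm.
  set A := component_approximation C pi m.
  have [[dA piA sAC cA] Amax] := component_approximation_largest kpi km piC.
  have Ay : interior A y.
    by apply: interiorS ly; apply: component_approximation_le kpi _ piC; apply/andP.
  (* The interiors of A and Q share y, which makes their union a competitor. *)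
  have admAQ : admissible C pi m (\bigcup_(X in [set A; Q]) X).
    split.
    + by apply: drawn_on_bigcup => X [->|->].
    + by move=> z /piA Az; exists A => //; left.
    + by move=> z [X [->|->]]; [exact: sAC|move=> /Qxe; exact: xeC].
    + apply: (@connected_interior_bigcup _ _ _ _ y) => X [->|->] //.
      * exact: drawn_sub_closure_interior dA.
      * exact: drawn_sub_closure_interior dQ.
      * exact: eQ.
  exists m => //=; apply: interiorS (eQ x (ballxx _ e20)).
  by move=> z Qz; apply: (Amax _ admAQ); exists Q => //; right.
Unshelve. all: by end_near. Qed.

End approximation_of_a_component.

Section approximation_of_an_open_set.
Context {R : realType} {n : nat}.
Variables (Omega : set 'rV[R]_n) (M : set nat) (C_ : nat -> set 'rV[R]_n).
Variables (k_ : nat -> nat) (pi_ : nat -> set 'rV[R]_n).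
Hypotheses (oOmega : open Omega) (C_components : enumerates_components Omega M C_).
Hypothesis pi_cube : forall m, M m -> dyadic_grid (k_ m) (pi_ m).
Hypothesis pi_sub : forall m, M m -> pi_ m `<=` C_ m.

Let Omega_ := dyadic_approximation M C_ k_ pi_.

Let componentP m : M m -> exists x, C_ m = connected_component Omega x.
Proof.
move=> Mm; have [fC _ _] := C_components.
by have [x _ <-] := fC m Mm; exists x.
Qed.

Lemma dyadic_approximation_open k : open (Omega_ k).
Proof. exact: open_interior. Qed.

Lemma dyadic_approximation_le k l : (k <= l)%N -> Omega_ k `<=` Omega_ l.
Proof.
move=> kl; apply: interiorS => x [m [Mm kmk] mx].
exists m; first by split=> //; exact: leq_trans kmk kl.
apply: component_approximation_le (pi_cube Mm) _ (pi_sub Mm) _ mx.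
by rewrite kmk.
Qed.

Lemma dyadic_approximation_bigcup : \bigcup_k Omega_ k = Omega.
Proof.
apply/seteqP; split => [x [k _ /interior_subset[m [Mm kmk]]]|x Ox].
  move=> /(component_approximation_sub (pi_cube Mm) kmk (pi_sub Mm)).
  by have [y ->] := componentP Mm; exact: connected_component_sub.
have [_ _ sC] := C_components.
have [m Mm CmE] : (C_ @` M) (connected_component Omega x) by apply: sC; exists x.
have Cmx : C_ m x by rewrite CmE; exact: connected_component_refl.
have oC : open (C_ m) by rewrite CmE; exact: connected_component_open.
have cC : connected (C_ m) by rewrite CmE; exact: component_connected.
move: Cmx.
rewrite -(component_approximation_exhaustion oC cC (pi_cube Mm) (pi_sub Mm)).
move=> [k kmk kx]; exists k => //; apply: filterS kx => y ky.
by exists m.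
Qed.

End approximation_of_an_open_set.

(** * Euclidean balls and the Hausdorff distance *)

Section euclidean_facts.
Context {R : realType} {n : nat}.
Implicit Types (x y z c : 'rV[R]_n) (A B : set 'rV[R]_n).

Lemma euclidean_norm_ge0 x : 0 <= euclidean_norm x.
Proof. exact: sqrtr_ge0. Qed.

Lemma euclidean_normZ (t : R) x :
  euclidean_norm (t *: x) = `|t| * euclidean_norm x.
Proof.
rewrite /euclidean_norm -sqrtr_sqr -sqrtrM ?sqr_ge0// mulr_sumr.
by congr Num.sqrt; apply: eq_bigr => i _; rewrite mxE exprMn.
Qed.

Lemma euclidean_distC x y : euclidean_norm (x - y) = euclidean_norm (y - x).
Proof. by rewrite -opprB -scaleN1r euclidean_normZ normrN1 mul1r. Qed.

Lemma euclidean_norm0 : euclidean_norm (0 : 'rV[R]_n) = 0.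
Proof. by rewrite -(scale0r (0 : 'rV_n)) euclidean_normZ normr0 mul0r. Qed.

Lemma coord_le_euclidean_norm x i : `|x 0 i| <= euclidean_norm x.
Proof.
rewrite -sqrtr_sqr ler_sqrt ?sumr_ge0// => [|j _]; last exact: sqr_ge0.
by rewrite (bigD1 i)//= lerDl sumr_ge0// => j _; exact: sqr_ge0.
Qed.

Lemma euclidean_dist_continuous c : continuous (fun x => euclidean_norm (x - c)).
Proof.
have coord i : continuous (fun x : 'rV[R]_n => x 0 i - c 0 i).
  by move=> x; apply: continuousB; [exact: coord_continuous|exact: cst_continuous].
have coord2 i : continuous (fun x : 'rV[R]_n => (x 0 i - c 0 i) ^+ 2).
  move=> x; apply: (@continuous_comp _ _ _ (fun x : 'rV[R]_n => x 0 i - c 0 i)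
    (fun t => t ^+ 2)); [exact: coord|exact: exprn_continuous].
move=> x; apply: (@continuous_comp _ _ _ (fun x => \sum_(i < n) (x - c) 0 i ^+ 2)).
  apply: continuous_big => [|i _]; first exact: add_continuous.
  by under eq_fun do rewrite !mxE; exact: coord2.
exact: sqrt_continuous.
Qed.

Lemma euclidean_ball_open c r : open (euclidean_ball c r).
Proof.
rewrite (_ : euclidean_ball c r = (fun x => euclidean_norm (x - c)) @^-1` [set t | t < r]).
  by apply: open_comp; [move=> x _; exact: euclidean_dist_continuous|exact: open_lt].
by [].
Qed.

Lemma euclidean_ball_center c r : 0 < r -> euclidean_ball c r c.
Proof. by rewrite /euclidean_ball/= subrr euclidean_norm0. Qed.

Lemma closed_box_compact (u v : 'I_n -> R) : compact (closed_box u v).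
Proof.
have := @rV_compact _ n (fun i => `[u i, v i]%classic) (fun i => @segment_compact R (u i) (v i)).
by congr compact; apply/seteqP; split => x xuv i; have := xuv i; rewrite /= in_itv.
Qed.

Lemma closure_euclidean_ball_compact c r : compact (closure (euclidean_ball c r)).
Proof.
have cbox := @closed_box_compact (fun i => c 0 i - r) (fun i => c 0 i + r).
apply: (subclosed_compact _ cbox); first exact: closed_closure.
rewrite closureE => x; apply; split.
  by apply: compact_closed cbox; exact: norm_hausdorff.
move=> y /= yr i; have := le_lt_trans (coord_le_euclidean_norm _ i) yr.
by rewrite !mxE ltr_norml; lra.
Qed.

(** On a segment avoiding the boundary, the interior of A would agree with its
    closure, hence be open and closed in the segment. *)
Lemma segment_meets_boundary A y z : ~ A y -> A z ->
  exists2 t : R, 0 <= t <= 1 & boundary A (y + t *: (z - y)).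
Proof.
move=> Ay Az; apply: contrapT => noboundary.
have clint x : segment y z x -> closure A x -> interior A x.
  move=> [t t01 <-] clA; apply: contrapT => intA; apply: noboundary.
  by exists t => //; move: t01; rewrite /= in_itv.
have : segment y z `&` interior A = segment y z.
  apply: (@connected_segment _ _ y z).
  - exists z; split; first exact: segment_end.
    by apply: clint; [exact: segment_end|exact: subset_closure].
  - by exists (interior A) => //; exact: open_interior.
  - exists (closure A); first exact: closed_closure.
    apply/seteqP; split => x [yzx Ax]; split=> //; last exact: clint.
    by apply: subset_closure; exact: interior_subset.
move=> /seteqP[_ /(_ _ (segment_start y z))[_ /interior_subset]].
exact: Ay.
Qed.

Lemma hausdorff_dist_ge0 A B : (0 <= hausdorff_dist A B)%E.
Proof. by rewrite /hausdorff_dist le_max lexx. Qed.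

Lemma hausdorff_dist_le A B (e : R) : 0 <= e ->
  (forall x, A x -> exists2 y, B y & euclidean_norm (x - y) <= e) ->
  (forall y, B y -> exists2 x, A x & euclidean_norm (y - x) <= e) ->
  (hausdorff_dist A B <= e%:E)%E.
Proof.
move=> e0 AB BA; rewrite /hausdorff_dist !ge_max lee_fin e0/=.
apply/andP; split; apply: ge_ereal_sup => _ [x + <-].
  move=> /AB[y By xy]; apply: ge_ereal_inf.
  by exists (euclidean_norm (x - y))%:E; [exists y|rewrite lee_fin].
move=> /BA[y By xy]; apply: ge_ereal_inf.
by exists (euclidean_norm (x - y))%:E; [exists y|rewrite lee_fin].
Qed.

End euclidean_facts.

Lemma cvge0_le {R : realType} (f : nat -> \bar R) : (forall k, (0 <= f k)%E) ->
  (forall e : R, 0 < e -> \forall k \near \oo, (f k <= e%:E)%E) ->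
  f k @[k --> \oo] --> (0 : \bar R)%E.
Proof.
move=> f0 fe; apply/fine_cvgP; split.
  near=> k; rewrite ge0_fin_numE//; apply: (@le_lt_trans _ _ 1%:E); last exact: ltry.
  by near: k; exact: fe.
apply/cvgr0Pnorm_le => e e0; near=> k => /=.
have fke : (f k <= e%:E)%E by near: k; exact: fe.
rewrite ger0_norm ?fine_ge0// -lee_fin fineK// ge0_fin_numE//.
exact: le_lt_trans fke (ltry _).
Unshelve. all: by end_near. Qed.

Lemma cvg_hausdorff_near {R : realType} {n : nat} (A_ : nat -> set 'rV[R]_n) A :
  (forall e : R, 0 < e -> \forall k \near \oo, forall x, A_ k x ->
    exists2 y, A y & euclidean_norm (x - y) <= e) ->
  (forall e : R, 0 < e -> \forall k \near \oo, forall y, A y ->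
    exists2 x, A_ k x & euclidean_norm (y - x) <= e) ->
  cvg_hausdorff A_ A.
Proof.
move=> AkA AAk; apply: cvge0_le => [k|e e0]; first exact: hausdorff_dist_ge0.
near=> k; apply: hausdorff_dist_le (ltW e0) _ _; near: k.
- exact: AkA.
- exact: AAk.
Unshelve. all: by end_near. Qed.

(** * Monotone exhaustions by open sets *)

(** Monotonicity turns an open cover by the U_k into a local statement that holds
    for all large k, which is what the filter form of compactness asks for. *)
Lemma exhaustion_compact (T : topologicalType) (U_ : nat -> set T) (K : set T) :
  (forall k, open (U_ k)) -> (forall k l, (k <= l)%N -> U_ k `<=` U_ l) ->
  compact K -> K `<=` \bigcup_k U_ k -> \forall k \near \oo, K `<=` U_ k.
Proof.
move=> oU ndU /compact_near_coveringP cK KU.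
apply: (cK nat \oo U_) => x /KU[k _ Ukx].
near=> y l => /=; apply: (ndU k); first by near: l; exact: nbhs_infty_ge.
by near: y; apply: open_nbhs_nbhs; split.
Unshelve. all: by end_near. Qed.

Section exhaustion.
Context {R : realType} {n : nat}.
Variables (U_ : nat -> set 'rV[R]_n) (U : set 'rV[R]_n).
Hypothesis oU_ : forall k, open (U_ k).
Hypothesis ndU_ : forall k l, (k <= l)%N -> U_ k `<=` U_ l.
Hypothesis UE : \bigcup_k U_ k = U.

Let U_sub k : U_ k `<=` U.
Proof. by rewrite -UE => x kx; exists k. Qed.

Let oU : open U.
Proof. by rewrite -UE; exact: bigcup_open. Qed.

Lemma exhaustion_cvg_pointwise : cvg_pointwise U_ U.
Proof.
move=> x; apply: cvg_near_cst; rewrite !indicE.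
have [xU|xU] := pselect (U x).
  rewrite mem_set//; move: xU; rewrite -UE => -[k _ kx]; near=> l.
  by rewrite indicE mem_set//; apply: (ndU_ (k := k)) kx; near: l; exact: nbhs_infty_ge.
apply: nearW => k; rewrite indicE !memNset//.
by move=> /U_sub.
Unshelve. all: by end_near. Qed.

Lemma exhaustion_cvg_compact : cvg_compact U_ U.
Proof.
split=> [K cK KU|K cK KU].
  by apply: exhaustion_compact => //; rewrite UE.
by apply: nearW => k x /KU; apply: contra_not; apply: closureS; exact: U_sub.
Qed.

(** The points of K that are not e-close to K minus U form a compact subset F
    of U, which lies in U_k for large k.  If K is contained in U, then F
    is all of K and no point of K is left outside U_k. *)
Lemma exhaustion_complement_near (K : set 'rV[R]_n) (e : R) : compact K -> 0 < e ->
  \forall k \near \oo, forall x, (K `\` U_ k) x ->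
    exists2 y, (K `\` U) y & euclidean_norm (x - y) <= e.
Proof.
move=> cK e0; pose F := K `\` \bigcup_(y in K `\` U) euclidean_ball y e.
have cF : compact F.
  apply: (subclosed_compact _ cK); last by move=> x [].
  apply: closedI; first by apply: compact_closed cK; exact: norm_hausdorff.
  by apply: open_closedC; apply: bigcup_open => y _; exact: euclidean_ball_open.
have FU : F `<=` \bigcup_k U_ k.
  rewrite UE => x [Kx xfar]; apply: contrapT => Ux; apply: xfar.
  by exists x => //; exact: euclidean_ball_center.
apply: filterS (exhaustion_compact oU_ ndU_ cF FU) => k FUk x [Kx Ukx].
apply: contrapT => nox; apply/Ukx/FUk; split=> // -[y KUy xy].
by apply: nox; exists y => //; exact: ltW.
Qed.

(** The e-neighborhoods W_k of the U_k exhaust the closure of U, so that W_k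
    contains it for some k; a boundary point y of U is then e-close to a point of
    U_k while lying outside U_k. *)
Lemma exhaustion_boundary_near (e : R) : compact (closure U) -> 0 < e ->
  \forall k \near \oo, forall y, boundary U y ->
    exists2 x, boundary (U_ k) x & euclidean_norm (y - x) <= e.
Proof.
move=> cU e0; pose W_ k := \bigcup_(z in U_ k) euclidean_ball z e.
have oW k : open (W_ k) by apply: bigcup_open => z _; exact: euclidean_ball_open.
have ndW k l : (k <= l)%N -> W_ k `<=` W_ l.
  by move=> kl x [z /(ndU_ kl) lz zx]; exists z.
have UW : closure U `<=` \bigcup_k W_ k.
  move=> y /(_ (euclidean_ball y e)) [].
    apply: open_nbhs_nbhs; split; first exact: euclidean_ball_open.
    exact: euclidean_ball_center.
  rewrite -UE => z [[k _ kz] zy]; exists k => //; exists z => //.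
  by rewrite /euclidean_ball/= euclidean_distC.
apply: filterS (exhaustion_compact oW ndW cU UW) => k UWk y [clUy intUy].
have [z kz zy] := UWk _ clUy.
have nky : ~ U_ k y.
  by move=> ky; apply: intUy; apply: filterS (@U_sub k) _; exact: open_nbhs_nbhs.
have [t /andP[t0 t1] yzt] := segment_meets_boundary nky kz.
exists (y + t *: (z - y)) => //.
rewrite opprD addrA subrr add0r -scaleN1r scalerA euclidean_normZ mulN1r normrN.
rewrite ger0_norm// euclidean_distC (le_trans _ (ltW zy))//.
by rewrite ler_piMl// euclidean_norm_ge0.
Qed.

Lemma exhaustion_cvg_hausdorff_complement (K : set 'rV[R]_n) : compact K ->
  cvg_hausdorff (fun k => K `\` U_ k) (K `\` U).
Proof.
move=> cK; apply: cvg_hausdorff_near => e e0; first exact: exhaustion_complement_near.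
apply: nearW => k y [Ky Uy]; exists y; first by split=> // /U_sub.
by rewrite subrr euclidean_norm0 ltW.
Qed.

Lemma exhaustion_cvg_hausdorff_boundary : compact (closure U) ->
  cvg_hausdorff (fun k => boundary (U_ k)) (boundary U).
Proof.
move=> cU; apply: cvg_hausdorff_near => e e0; last exact: exhaustion_boundary_near.
apply: filterS (exhaustion_complement_near cU e0) => k near_k x [clkx intkx].
have [|y [clUy Uy] xy] := near_k x.
  split; first by apply: closureS clkx; exact: U_sub.
  by move=> kx; apply: intkx; apply: open_nbhs_nbhs.
by exists y => //; split=> // /interior_subset.
Qed.

End exhaustion.

(** * Convergence in the Lebesgue spaces *)

Section lebesgue.
Context {R : realType}.

Lemma closed_box_measurable n (u v : 'I_n -> R) :
  measurable (@row_of_tuple R n @^-1` closed_box u v).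
Proof.
rewrite (_ : _ @^-1` _ = \bigcap_(i in [set: 'I_n])
    ((@tnth n (measurableTypeR R))^~ i @^-1` `[u i, v i]%classic)).
  apply: fin_bigcap_measurable => [|i _]; first exact: finite_finset.
  rewrite -[X in measurable X]setTI.
  by apply: measurable_tnth => //; exact: measurable_itv.
apply/seteqP; split => t /= tuv i; last by have := tuv i I; rewrite /= in_itv mxE.
by move=> _; have := tuv i; rewrite /= in_itv mxE.
Qed.

Lemma closed_box_measure_lty n (u v : 'I_n -> R) :
  (lebesgue_tuple n (@row_of_tuple R n @^-1` closed_box u v) < +oo)%E.
Proof.
elim: n u v => [|n IHn] u v.
  rewrite /= diracE; exact: ltry.
rewrite /= /lebesgue_step /pushforward.
set B := (X in product_measure1 _ _ X).
have -> : B = `[u ord0, v ord0]%classic `*`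
    (@row_of_tuple R n @^-1` closed_box (u \o lift ord0) (v \o lift ord0)).
  apply/seteqP; split => -[x t] /=.
    move=> xt; split; first by have := xt ord0; rewrite mxE in_itv.
    by move=> i; have := xt (lift ord0 i); rewrite !mxE tnthS.
  move=> [x0 xt] i; rewrite mxE; case: (unliftP ord0 i) => [j ->|->].
    by have := xt j; rewrite mxE tnthS.
  by move: x0; rewrite in_itv.
rewrite product_measure1E; [|exact: measurable_itv|exact: closed_box_measurable].
apply: lte_mul_pinfty => //.
suff: lebesgue_measure (`[u ord0, v ord0]%classic : set R) \is a fin_num by [].
by rewrite lebesgue_measure_itv/=; case: ifP.
Qed.

(** Although the sigma-algebra on tuples is generated by the coordinates, it
    contains the open sets, since each of them is the union of the countably many
    dyadic cubes that it contains. *)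
Lemma open_measurable_tuple n (U : set 'rV[R]_n) : open U ->
  measurable (@row_of_tuple R n @^-1` U).
Proof.
move=> oU.
pose cube (kj : nat * {ffun 'I_n -> int}) : set 'rV[R]_n := dyadic_cube kj.1 kj.2.
pose F kj := if `[< cube kj `<=` U >] then @row_of_tuple R n @^-1` cube kj else set0.
have -> : @row_of_tuple R n @^-1` U = \bigcup_kj F kj.
  apply/seteqP; split => [t /= Ut|t [kj _]]; last first.
    by rewrite /F; case: asboolP => // sub; exact: sub.
  have /nbhs_ballP[e /= e0 teU] : nbhs (row_of_tuple t) U by exact: open_nbhs_nbhs.
  have e20 : 0 < e / 2 by rewrite divr_gt0.
  have [k ke] : exists k, (2 : R) ^- k < e / 2.
    near \oo => k; exists k.
    by rewrite -div1r; near: k; exact: (near_infty_natSinv_expn_lt (PosNum e20)).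
  have [Q [[P Pk QE] Qe eQ _]] := small_drawn_box (row_of_tuple t) e0 ke.
  have : Q (row_of_tuple t) by apply: interior_subset; apply: eQ; exact: ballxx.
  rewrite QE => -[pi Ppi pit]; have [j _ jpi] := Pk _ Ppi.
  have jE : cube (k, [ffun i => j i]) = pi.
    rewrite -jpi /cube /=; congr dyadic_cube; apply/funext => i; exact: ffunE.
  exists (k, [ffun i => j i]) => //; rewrite /F; case: asboolP; rewrite jE //.
  by case; move=> y piy; apply: teU; apply: Qe; rewrite QE; exists pi.
apply: countable_bigcupT_measurable => [|kj]; first exact: countableP.
rewrite /F; case: asboolP => // _.
by rewrite /cube dyadic_cube_box; exact: closed_box_measurable.
Unshelve. all: by end_near. Qed.

Lemma compact_measurable_tuple n (K : set 'rV[R]_n) : compact K ->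
  measurable (@row_of_tuple R n @^-1` K).
Proof.
move=> cptK; have cK : closed K.
  by apply: compact_closed cptK; exact: norm_hausdorff.
rewrite -[K]setCK preimage_setC; apply: measurableC.
have : open (~` K) by exact: closed_openC.
exact: open_measurable_tuple.
Qed.

Lemma compact_measure_lty n (K : set 'rV[R]_n) : compact K ->
  (lebesgue_tuple n (@row_of_tuple R n @^-1` K) < +oo)%E.
Proof.
move=> cK; have [m [_ Km]] := compact_bounded cK.
pose b := m + 1.
apply: le_lt_trans (closed_box_measure_lty (fun=> - b) (fun=> b)).
apply: le_measure; rewrite ?inE; [exact: compact_measurable_tuple|
  exact: closed_box_measurable|].
move=> t /= Kt i; have mb : m < b by rewrite ltrDl.
have : mx_norm (row_of_tuple t) <= b by exact: Km _ mb _ Kt.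
rewrite mx_normrE => /bigmax_leP[_ /(_ (0, i) isT)].
by rewrite /= ler_norml.
Qed.

Section exhaustion.
Context {n : nat}.
Variables (U_ : nat -> set 'rV[R]_n) (U : set 'rV[R]_n).
Hypothesis oU_ : forall k, open (U_ k).
Hypothesis ndU_ : forall k l, (k <= l)%N -> U_ k `<=` U_ l.
Hypothesis UE : \bigcup_k U_ k = U.

(** The integrand is the indicator function of D k whatever the exponent, so the
    claim reduces to continuity from above of the measure. *)
Lemma exhaustion_cvg_characteristic : cvg_characteristic U_ U.
Proof.
move=> p p1 K cK; have p0 : 0 < p by apply: lt_le_trans p1.
have oU : open U by rewrite -UE; exact: bigcup_open.
pose D k := @row_of_tuple R n @^-1` (K `&` (U `\` U_ k)).
have mD k : measurable (D k).
  rewrite /D preimage_setI; apply: measurableI; first exact: compact_measurable_tuple.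
  by apply: measurableD; exact: open_measurable_tuple.
have DK k : (lebesgue_tuple n (D k) <=
    lebesgue_tuple n (@row_of_tuple R n @^-1` K))%E.
  by apply: le_measure; rewrite ?inE//; [exact: compact_measurable_tuple|move=> t []].
have muD : lebesgue_tuple n (D k) @[k --> \oo] --> (0 : \bar R)%E.
  have capD : \bigcap_k D k = set0.
    apply/seteqP; split => // t Dt; have [_ [+ _]] := Dt O I; rewrite -UE.
    by move=> -[k _ kt]; have [_ [_]] := Dt k I; apply.
  rewrite -(measure0 (lebesgue_tuple n)) -capD; apply: nonincreasing_cvg_mu => //.
  - exact: le_lt_trans (DK O) (compact_measure_lty cK).
  - by rewrite capD.
  - move=> k l kl; apply/subsetPset => t [Kt [Ut lt]]; split=> //; split=> //.
    by move=> kt; apply: lt; exact: ndU_ kt.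
have LnormE k : Lnorm (lebesgue_tuple n) p%:E
    (fun t => ((((\1_(U_ k) \- \1_U) : 'rV[R]_n -> R) \_ K) (row_of_tuple t))%:E) =
    ((lebesgue_tuple n (D k)) `^ p^-1)%E.
  rewrite unlock -[in RHS](setIT (D k)) -integral_indic//; congr poweR.
  apply: eq_integral => t _; rewrite /= patchE !indicE.
  have [Kt|Kt] := boolP (row_of_tuple t \in K); last first.
    rewrite normr0 powR0 ?gt_eqF// memNset// => -[Kt' _].
    by rewrite mem_set in Kt.
  have -> : (t \in D k) = (row_of_tuple t \in U) && (row_of_tuple t \notin U_ k).
    rewrite /D; apply/idP/idP.
      by rewrite inE => -[_ [Ut kt]]; rewrite mem_set//= memNset.
    move=> /andP[Ut kt]; apply/mem_set; rewrite !inE in Kt Ut.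
    by split=> //; split=> // /mem_set; exact/negP.
  rewrite /= !indicE; have [kt|kt] := boolP (row_of_tuple t \in U_ k).
    have Ut : U (row_of_tuple t) by rewrite -UE; exists k => //; exact/set_mem.
    by rewrite (mem_set Ut) subrr normr0 powR0 ?gt_eqF.
  case: (_ \in U); rewrite ?sub0r ?normrN ?normr1 ?powR1//=.
  by rewrite normr0 powR0 ?gt_eqF.
under eq_fun do rewrite LnormE.
apply: cvge0_le => [k|e e0]; first exact: poweR_ge0.
near=> k.
(* Raising to the power 1 / p is monotone, so e `^ p is the bound to reach. *)
rewrite [leRHS](_ : _ = ((e `^ p)%:E `^ p^-1)%E); last first.
  by rewrite poweR_EFin -powRrM mulfV ?gt_eqF// powRr1// ltW.
apply: gt0_ler_poweR; rewrite ?invr_ge0 ?(ltW p0)//.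
- by rewrite in_itv/= measure_ge0 leey.
- by rewrite in_itv/= lee_fin powR_ge0 leey.
near: k; have ep : 0 < e `^ p by rewrite powR_gt0.
have /fine_cvgP[ffin /cvgr0Pnorm_le /(_ _ ep)] := muD.
move=> near_ep; near=> k; rewrite -(@fineK _ (lebesgue_tuple n (D k))); last by near: k.
rewrite lee_fin; apply: le_trans (ler_norm _) _.
by near: k.
Unshelve. all: by end_near. Qed.

End exhaustion.
End lebesgue.

Theorem theorem2p1 (R : realType) (n : nat) (n_ge2 : (2 <= n)%N)
    (Omega : set 'rV[R]_n) (oOmega : open Omega)
    (M : set nat) (M_index : index_set M)
    (C_ : nat -> set 'rV[R]_n) (C_components : enumerates_components Omega M C_)
    (k_ : nat -> nat)
    (k_nondecreasing : forall m m' : nat, M m -> M m' -> (m <= m')%N -> (k_ m <= k_ m')%N)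
    (pi_ : nat -> set 'rV[R]_n)
    (pi_cube : forall m : nat, M m -> dyadic_grid (k_ m) (pi_ m))
    (pi_sub : forall m : nat, M m -> pi_ m `<=` C_ m) :
  let Omega_ := dyadic_approximation M C_ k_ pi_ in
  [/\
      (forall k : nat, open (Omega_ k) /\ Omega_ k `<=` Omega) /\
      (forall k l : nat, (k <= l)%N -> Omega_ k `<=` Omega_ l),
      cvg_pointwise Omega_ Omega /\ cvg_characteristic Omega_ Omega,
      cvg_compact Omega_ Omega &
      forall (c : 'rV[R]_n) (r : R), 0 < r ->
        let B := euclidean_ball c r in
        cvg_hausdorff_open B (fun k => Omega_ k `&` B) (Omega `&` B) /\
        cvg_hausdorff (fun k => boundary (Omega_ k `&` B)) (boundary (Omega `&` B))].
Proof.
move=> Omega_.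
have oO k : open (Omega_ k) by exact: dyadic_approximation_open.
have ndO k l : (k <= l)%N -> Omega_ k `<=` Omega_ l.
  by move=> kl; exact: dyadic_approximation_le pi_cube pi_sub k l kl.
have OE : \bigcup_k Omega_ k = Omega.
  exact: dyadic_approximation_bigcup oOmega C_components pi_cube pi_sub.
split.
- split=> // k; split=> //.
  by rewrite -OE => x kx; exists k.
- split; first exact: exhaustion_cvg_pointwise ndO OE.
  exact: exhaustion_cvg_characteristic oO ndO OE.
- exact: exhaustion_cvg_compact oO ndO OE.
move=> c r r0 B.
have oB k : open (Omega_ k `&` B) by apply: openI => //; exact: euclidean_ball_open.
have ndB k l : (k <= l)%N -> Omega_ k `&` B `<=` Omega_ l `&` B.
  by move=> kl; apply: setSI; exact: ndO.
have BE : \bigcup_k (Omega_ k `&` B) = Omega `&` B by rewrite -setI_bigcupl OE.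
have cB : compact (closure B) by exact: closure_euclidean_ball_compact.
split; first exact: exhaustion_cvg_hausdorff_complement oB ndB BE _ cB.
apply: (exhaustion_cvg_hausdorff_boundary oB ndB BE).
by apply: (subclosed_compact _ cB); [exact: closed_closure|apply: closureS => x []].
Qed.
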